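(* Every residually finite faithful weakly hyperbolic group is lim-free. In particular, every finitely generated linear faithful weakly hyperbolic group is lim-free.
   Context: A hyperbolic space is a geodesic metric space $S$ (not assumed proper) such that for some $\delta\ge 0$, $\langle x|y\rangle_o\ge\min\{\langle x|z\rangle_o,\langle z|y\rangle_o\}-\delta$ for all $x,y,z,o\in S$, where $\langle x|y\rangle_o=\frac12(d(x,o)+d(y,o)-d(x,y))$. Its Gromov boundary $\partial S$ is the set of equivalence classes of sequences $(x_i)$ in $S$ with $\langle x_i|x_j\rangle_o\to\infty$ as $i,j\to\infty$, where $(x_i)\sim(y_i)$ iff $\langle x_i|y_j\rangle_o\to\infty$; a sequence in the class $a$ is said to converge to $a$. For $a,b\in\partial S$, $\langle a|b\rangle_o$ is the infimum of $\liminf_{i,j}\langle x_i|y_j\rangle_o$ over sequences $x_i\to a$, $y_j\to b$; $\partial S$ is topologized so that the sets $\{b\in\partial S:\langle a|b\rangle_o>r\}$, $r\ge 0$, form a neighborhood base at $a$. All group actions on hyperbolic spaces are by isometries; they extend to actions by homeomorphisms on $\partial S$. The limit set $\Lambda_S(G)\subseteq\partial S$ of a group $G$ acting on $S$ is the set of points of $\partial S$ that are limits of sequences in an orbit $Gs$ (independent of $s\in S$), with the subspace topology. An element $g\in G$ is loxodromic if $\langle g\rangle$ has unbounded orbits in $S$ and fixes exactly two points of $\partial S$. The action of $G$ on $S$ is of general type if its orbits are unbounded and $G$ contains two loxodromic elements with disjoint fixed point sets in $\partial S$. An action by homeomorphisms on a topological space $X$ is topologically free if for every nontrivial element $g$ the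 set of fixed points of $g$ in $X$ has empty interior. A group is faithful weakly hyperbolic if it admits a general type action on a hyperbolic space such that the induced action on the limit set is faithful. It is lim-free if it admits a general type action on a hyperbolic space such that the induced action on the limit set is topologically free. A group is linear if it embeds in $GL_n(k)$ for some $n$ and some field $k$. *)

(* Defs.v *)
From HB Require Import structures.
From mathcomp Require Import all_boot all_order all_algebra all_fingroup.
From mathcomp Require Import all_classical all_reals all_analysis.
From mathcomp Require Import lra.

Set Implicit Arguments.
Unset Strict Implicit.
Unset Printing Implicit Defensive.

Import Order.TTheory GRing.Theory Num.Theory.
Import numFieldNormedType.Exports.

Local Open Scope classical_set_scope.
Local Open Scope ring_scope.

Section Groups.
Variable G : groupType.

Definition subgroup_generated (A : set G) : set G :=
  smallest (fun H : set G => group_closed (mem H)) A.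

Definition finitely_generated : Prop :=
  exists2 A : set G, finite_set A & subgroup_generated A = setT.

Definition residually_finite : Prop :=
  forall g : G, g <> 1%g ->
    exists (Q : finGroupType) (f : {multiplicative G -> Q}), f g <> 1%g.

(* [f 1 = 1%:M] follows, as [f 1] is invertible and idempotent. *)
Definition linear_group : Prop :=
  exists (n : nat) (k : fieldType) (f : G -> 'M[k]_n),
    [/\ injective f, forall g, f g \in unitmx
      & forall g h, f (g * h)%g = f g *m f h].

End Groups.

Section GromovProduct.
Context {R : realType} {S : metricType R}.
Implicit Types (o s t : S) (x y : nat -> S).

Definition geodesic_space : Prop :=
  forall s t, exists c : R -> S,
    [/\ c 0 = s, c (mdist s t) = t &
        {in `[0, mdist s t] &, forall u v, mdist (c u) (c v) = `|u - v|}].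

Definition gromov_product o s t : R :=
  (mdist s o + mdist t o - mdist s t) / 2.

Definition hyperbolic_space : Prop :=
  geodesic_space /\
  exists2 delta : R, 0 <= delta &
    forall s t u o,
      Num.min (gromov_product o s u) (gromov_product o u t) - delta
        <= gromov_product o s t.

(* Changing [o] alters Gromov products by a bounded amount, so quantifying over
   all base points here and in [open_boundary] amounts to fixing one. *)
Definition asymptotic x y : Prop :=
  forall o, gromov_product o (x ij.1) (y ij.2) @[ij --> (\oo, \oo)] --> +oo.

Definition converges_at_infinity x : Prop := asymptotic x x.

Definition asymptotic_class x : set (nat -> S) :=
  [set y | converges_at_infinity y /\ asymptotic x y].

Definition unbounded (A : set S) : Prop :=
  forall M : R, exists s t, [/\ A s, A t & M < mdist s t].

End GromovProduct.

Arguments geodesic_space {R} S.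
Arguments hyperbolic_space {R} S.

Section Boundary.
Context {R : realType}.

Definition boundary (S : metricType R) : Type :=
  {A : set (nat -> S) |
    exists2 x, converges_at_infinity x & A = asymptotic_class x}.

Definition converges_to (S : metricType R) (x : nat -> S) (a : boundary S) :=
  sval a x.

Definition boundary_product (S : metricType R) (o : S) (a b : boundary S)
    : \bar R :=
  ereal_inf [set l | exists x y, [/\ converges_to x a, converges_to y b &
    l = limf_einf (fun ij => (gromov_product o (x ij.1) (y ij.2))%:E)
                  (filter_prod \oo \oo)]].

Definition boundary_nbhd (S : metricType R) (o : S) (a : boundary S) (r : R)
    : set (boundary S) :=
  [set b | (r%:E < boundary_product o a b)%E].

(* The open sets of the only topology in which the sets [boundary_nbhd o a r],
   which need not be open, can form a neighborhood base at [a]; for hyperbolic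
   [S] they do, see [nbhs_boundaryP]. *)
Definition open_boundary (S : metricType R) (U : set (boundary S)) : Prop :=
  forall (o : S) a, U a -> exists2 r, 0 <= r & boundary_nbhd o a r `<=` U.

Variable S : metricType R.

HB.instance Definition _ := gen_eqMixin (boundary S).
HB.instance Definition _ := gen_choiceMixin (boundary S).

Let open_boundaryT : open_boundary [set: boundary S].
Proof. by move=> o a _; exists 0. Qed.

Let open_boundaryI : setI_closed (@open_boundary S).
Proof.
move=> U V oU oV o a [/(oU o)[r r0 rU] /(oV o)[t t0 tV]].
exists (Num.max r t) => [|b]; first by rewrite le_max r0.
rewrite /boundary_nbhd/= EFin_max gt_max => /andP[rb tb].
by split; [exact: rU|exact: tV].
Qed.

Let open_boundary_bigcup (I : Type) (f : I -> set (boundary S)) :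
  (forall i, open_boundary (f i)) -> open_boundary (\bigcup_i f i).
Proof.
move=> fo o a [i _ /(fo i o)[r r0 rf]]; exists r => // b /rf fb.
by exists i.
Qed.

HB.instance Definition _ := isOpenTopological.Build (boundary S)
  open_boundaryT open_boundaryI open_boundary_bigcup.

End Boundary.

Section HyperbolicBoundary.
Context {R : realType} {S : metricType R}.
Hypothesis hypS : hyperbolic_space S.
Implicit Types (o s t : S) (x y z : nat -> S) (a b c : boundary S).

Lemma gromov_product_base o o' s t :
  gromov_product o s t <= gromov_product o' s t + mdist o o'.
Proof.
have := metric_triangle s o' o; have := metric_triangle t o' o.
by rewrite (metric_sym o o') /gromov_product; lra.
Qed.

Lemma gromov_productC o s t : gromov_product o s t = gromov_product o t s.
Proof. by rewrite /gromov_product (metric_sym s t) [_ + mdist t o]addrC. Qed.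

Lemma asymptoticP x y : asymptotic x y <->
  forall o M, exists N, forall i j, (N <= i)%N -> (N <= j)%N ->
    M <= gromov_product o (x i) (y j).
Proof.
split=> [xy o M|xy o].
  have /cvgryPge/(_ M)[[/= A B] [[n _ nA] [m _ mB]] AB] := xy o.
  exists (maxn n m) => i j; rewrite !geq_max => /andP[ni _] /andP[_ mj].
  by apply: (AB (i, j)); split; [exact: nA|exact: mB].
apply/cvgryPge => M; have [N NM] := xy o M.
exists ([set i | (N <= i)%N], [set i | (N <= i)%N]).
  by split; exists N.
by move=> [i j] [/= Ni Nj]; exact: NM.
Qed.

Lemma asymptotic_sym x y : asymptotic x y -> asymptotic y x.
Proof.
move=> /asymptoticP xy; apply/asymptoticP => o M; have [N NM] := xy o M.
by exists N => i j Ni Nj; rewrite gromov_productC NM.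
Qed.

Lemma asymptotic_trans x y z :
  asymptotic x y -> asymptotic y z -> asymptotic x z.
Proof.
case: hypS => _ [d d0 hyp] /asymptoticP xy /asymptoticP yz.
apply/asymptoticP => o M.
have [N NM] := xy o (M + d); have [N' NM'] := yz o (M + d).
exists (maxn N N') => i j; rewrite !geq_max => /andP[Ni _] /andP[_ N'j].
apply: le_trans (hyp _ _ (y (maxn N N')) o).
by rewrite lerBrDr le_min NM ?NM' ?leq_maxl ?leq_maxr.
Qed.

Lemma converges_to_ex a : exists x, converges_to x a.
Proof. by case: a => _ /= [x xx ->]; exists x; split. Qed.

Lemma converges_to_asymptotic x y a :
  converges_to x a -> converges_to y a -> asymptotic x y.
Proof.
case: a => A [z zz eqA]; rewrite /converges_to /= eqA => -[_ zx] [_ zy].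
exact: asymptotic_trans (asymptotic_sym zx) zy.
Qed.

Lemma boundary_product_gt o a b (r : R) : (r%:E < boundary_product o a b)%E ->
  forall x y, converges_to x a -> converges_to y b ->
    exists N, forall i j, (N <= i)%N -> (N <= j)%N ->
      r <= gromov_product o (x i) (y j).
Proof.
move=> rab x y xa yb.
have : (r%:E < limf_einf (fun ij => (gromov_product o (x ij.1) (y ij.2))%:E)
                  (filter_prod \oo \oo))%E.
  by apply: lt_le_trans rab _; apply: ereal_inf_lbound; exists x, y.
rewrite limf_einfE => /ereal_sup_gt[_ [V [[A B] [[n _ nA] [m _ mB]] AB] <-] rV].
exists (maxn n m) => i j; rewrite !geq_max => /andP[ni _] /andP[_ mj].
rewrite -lee_fin; apply: le_trans (ltW rV) _; apply: ereal_inf_lbound.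
by exists (i, j) => //; apply: AB; split; [exact: nA|exact: mB].
Qed.

Lemma boundary_product_ge o a b (r : R) :
  (forall x y, converges_to x a -> converges_to y b ->
    exists N, forall i j, (N <= i)%N -> (N <= j)%N ->
      r <= gromov_product o (x i) (y j)) ->
  (r%:E <= boundary_product o a b)%E.
Proof.
move=> rab; apply: le_ereal_inf_tmp => _ [x [y [xa yb ->]]].
have [N Nr] := rab x y xa yb.
rewrite limf_einfE; apply: le_ereal_sup_tmp; eexists.
  exists ([set i | (N <= i)%N] `*` [set i | (N <= i)%N]); last by reflexivity.
  exists ([set i | (N <= i)%N], [set i | (N <= i)%N]) => //.
  by split; exists N.
by apply: le_ereal_inf_tmp => _ [[i j] [/= Ni Nj] <-]; rewrite lee_fin Nr.
Qed.

Lemma boundary_product_base o o' a b (r : R) :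
  ((r + mdist o' o)%:E < boundary_product o a b)%E ->
  (r%:E <= boundary_product o' a b)%E.
Proof.
move=> rab; apply: boundary_product_ge => x y xa yb.
have [N Nr] := boundary_product_gt rab xa yb.
exists N => i j Ni Nj.
have := Nr i j Ni Nj; have := gromov_product_base o o' (x i) (y j).
by rewrite (metric_sym o' o); lra.
Qed.

Lemma boundary_product_self o a : boundary_product o a a = +oo%E.
Proof.
apply/eqyP => r r0; apply: boundary_product_ge => x y xa ya.
by have /asymptoticP/(_ o r) := converges_to_asymptotic xa ya.
Qed.

Lemma nbhs_boundaryP o a (A : set (boundary S)) :
  nbhs a A <-> exists2 r, 0 <= r & boundary_nbhd o a r `<=` A.
Proof.
split=> [|[r r0 rA]].
  rewrite nbhsE => -[U [oU Ua] UA].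
  by have [r r0 rU] := (oU : open_boundary U) o a Ua; exists r => // b /rU /UA.
have self b (t : R) : boundary_nbhd o b t b.
  by rewrite /boundary_nbhd/= boundary_product_self ltry.
rewrite nbhsE; exists [set b | exists2 t, 0 <= t & boundary_nbhd o b t `<=` A].
  split; last by exists r.
  change (open_boundary [set b | exists2 t, 0 <= t & boundary_nbhd o b t `<=` A]).
  case: hypS => _ [d d0 hyp] o' b [t t0 tA].
  exists (t + 2 + d + mdist o o') => [|c bc].
    by rewrite !addr_ge0 ?mdist_ge0.
  have {}bc : ((t + 1 + d)%:E < boundary_product o b c)%E.
    apply: lt_le_trans (boundary_product_base bc).
    by rewrite lte_fin; lra.
  exists (t + 1 + d) => [|e ce]; first by rewrite !addr_ge0.
  apply: tA; apply: (@lt_le_trans _ _ (t + 1)%:E); first by rewrite lte_fin; lra.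
  apply: boundary_product_ge => x z xb ze.
  have [y yc] := converges_to_ex c.
  have [N Nr] := boundary_product_gt bc xb yc.
  have [M Mr] := boundary_product_gt ce yc ze.
  exists (maxn N M) => i j; rewrite !geq_max => /andP[Ni _] /andP[_ Mj].
  apply: le_trans (hyp _ _ (y (maxn N M)) o).
  by rewrite lerBrDr le_min Nr ?Mr ?leq_maxl ?leq_maxr.
by move=> b [t t0]; apply; exact: self.
Qed.

End HyperbolicBoundary.

Record isometric_action (G : groupType) (R : realType) (S : metricType R) :=
  IsometricAction {
    iact :> G -> S -> S;
    iact1 : forall s, iact 1%g s = s;
    iactM : forall g h s, iact (g * h)%g s = iact g (iact h s);
    iact_isometry : forall g s t, mdist (iact g s) (iact g t) = mdist s t
  }.

Section Actions.
Context {G : groupType} {R : realType} {S : metricType R}.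
Variable a : isometric_action G S.

Lemma iactK g : cancel (a g) (a g^-1%g).
Proof. by move=> s; rewrite -iactM mulVg iact1. Qed.

Lemma iactVK g : cancel (a g^-1%g) (a g).
Proof. by move=> s; rewrite -iactM mulgV iact1. Qed.

Lemma iact_gromov_product g o s t :
  gromov_product (a g o) (a g s) (a g t) = gromov_product o s t.
Proof. by rewrite /gromov_product !iact_isometry. Qed.

Lemma iact_asymptotic g x y : asymptotic x y -> asymptotic (a g \o x) (a g \o y).
Proof.
move=> xy o; rewrite -(iactVK g o).
under eq_fun do rewrite iact_gromov_product.
exact: xy.
Qed.

Lemma iact_asymptotic_class g x :
  [set a g \o y | y in asymptotic_class x] = asymptotic_class (a g \o x).
Proof.
apply/seteqP; split=> [_ [y [yy xy] <-]|y [yy xy]].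
  by split; exact: iact_asymptotic.
have aK (z : nat -> S) : a g^-1%g \o (a g \o z) = z by apply/funext => i /=; rewrite iactK.
exists (a g^-1%g \o y); last by apply/funext => i /=; rewrite iactVK.
by split; [|rewrite -(aK x)]; exact: iact_asymptotic.
Qed.

Lemma iact_boundary_subproof g (p : boundary S) :
  exists2 x, converges_at_infinity x &
    [set a g \o y | y in sval p] = asymptotic_class x.
Proof.
case: p => _ /= [x xx ->]; exists (a g \o x); first exact: iact_asymptotic.
exact: iact_asymptotic_class.
Qed.

Definition iact_boundary g (p : boundary S) : boundary S :=
  exist _ _ (iact_boundary_subproof g p).

Definition fixed_boundary g : set (boundary S) :=
  [set p | iact_boundary g p = p].

Definition limit_set : set (boundary S) :=
  [set p | exists s (u : nat -> G), converges_to (fun i => a (u i) s) p].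

Lemma iact_limit_set_subproof g (p : limit_set) :
  iact_boundary g (set_val p) \in limit_set.
Proof.
have /set_mem[s [u us]] := valP p; apply/mem_set.
exists s, (fun i => g * u i)%g; exists (fun i => a (u i) s) => //.
by apply/funext => i /=; rewrite iactM.
Qed.

(* The set [limit_set], used as a type, carries the subspace topology. *)
Definition iact_limit_set g (p : limit_set) : limit_set :=
  exist (fun q => q \in limit_set) _ (iact_limit_set_subproof g p).

Definition loxodromic g : Prop :=
  (forall s, unbounded [set a h s | h in subgroup_generated [set g]]) /\
  exists p q, p <> q /\ fixed_boundary g = [set p; q].

Definition general_type : Prop :=
  (forall s, unbounded (range (a^~ s))) /\
  exists g h, [/\ loxodromic g, loxodromic h &
    fixed_boundary g `&` fixed_boundary h = set0].

End Actions.

Arguments iact_limit_set {G R S} a g p.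

Definition faithful_action (G : groupType) (X : Type) (f : G -> X -> X) : Prop :=
  forall g, (forall x, f g x = x) -> g = 1%g.

Definition topologically_free (G : groupType) (X : topologicalType)
    (f : G -> X -> X) : Prop :=
  forall g, g <> 1%g -> interior [set x | f g x = x] = set0.

Definition faithful_weakly_hyperbolic (R : realType) (G : groupType) : Prop :=
  exists (S : metricType R) (a : isometric_action G S),
    [/\ hyperbolic_space S, general_type a
      & faithful_action (iact_limit_set a)].

Definition lim_free (R : realType) (G : groupType) : Prop :=
  exists (S : metricType R) (a : isometric_action G S),
    [/\ hyperbolic_space S, general_type a
      & topologically_free (iact_limit_set a)].

(* Main.v *)
(* The given action is already topologically free.  Suppose [g <> 1] fixes a
   nonempty open subset [U] of the limit set pointwise.  Some [w] conjugate to
   [g] is supported in a small open set displaced by [g], so [m = [~ g, w]] is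
   nontrivial and is a commutator of two elements fixing [U].  For [n <> 1] in
   the kernel of a homomorphism, pick an open [V] with [n V] disjoint from [V]:
   since some [h] compresses the complement of [U] into [V], conjugates [x], [y]
   of [g], [w] by [h] are supported in [V], [n x^-1 n^-1] commutes with [y], and
   [~ x, y] = [~ x n x^-1 n^-1, y] is in the kernel.  So a homomorphism to a
   finite group not killing [m] is injective, and [G] is finite, contradicting
   the unboundedness of orbits.

   The compressing element is [v c u^-1] with [u s], [v s] close to points of
   [U], [V], and [c] one of three elements chosen so that [c u^-1 s] and
   [v^-1 s] lie in different directions from [s].

   The linear case is Malcev's theorem, which comes from extending
   homomorphisms to finite fields along [A < A[t]] one generator at a time. *)
Require Import Defs.
From HB Require Import structures.
From mathcomp Require Import all_boot all_order all_algebra all_fingroup.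
From mathcomp Require Import all_field.
From mathcomp Require Import all_classical all_reals all_analysis.
From mathcomp Require Import lra.

Set Implicit Arguments.
Unset Strict Implicit.
Unset Printing Implicit Defensive.

Import Order.TTheory GRing.Theory Num.Theory.
Import numFieldNormedType.Exports.

Local Open Scope classical_set_scope.
Local Open Scope ring_scope.

(** * Homomorphisms from finitely generated domains to finite fields *)

Lemma finField_ext_root (F : finFieldType) (p : {poly F}) : (1 < size p)%N ->
  exists (F' : finFieldType) (i : {rmorphism F -> F'}) (x : F'),
    (map_poly i p).[x] = 0.
Proof.
move=> p1; have p0 : p != 0 by rewrite -size_poly_gt0 ltnW.
have [L [rs pE _]] := FinSplittingFieldFor p0.
exists (finvect_type L), (GRing.in_alg (finvect_type L)).
case: rs pE => [|x rs] pE.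
  by move: (eqp_size pE) p1; rewrite big_nil size_poly1 size_map_poly => ->.
exists x; apply/eqP; change (root (map_poly (GRing.in_alg L) p) x).
by rewrite (eqp_root pE) root_prod_XsubC mem_head.
Qed.

(** Every element of [F] may be a root of [p], but at a root of [p * 'X - 1] in an extension the
    value of [p] is invertible. *)
Lemma finField_ext_nonroot (F : finFieldType) (p : {poly F}) : p != 0 ->
  exists (F' : finFieldType) (i : {rmorphism F -> F'}) (x : F'),
    (map_poly i p).[x] != 0.
Proof.
move=> p0; have : (1 < size (p * 'X - 1)%R)%N.
  by rewrite size_polyDl size_mulX ?size_polyN ?size_poly1 ?ltnS ?size_poly_gt0.
move=> /finField_ext_root[F' [i [x]]].
rewrite rmorphB rmorphM /= rmorph1 map_polyX !hornerE => /eqP.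
rewrite subr_eq0 => /eqP px; exists F', i, x; apply: contra_eq_neq px => ->.
by rewrite mul0r eq_sym oner_neq0.
Qed.

(* The image of [psi] is a finitely generated subring [A] of [K]; to avoid
   subtypes, a homomorphism on [A] is given as some [phi] on [R] that kills the
   kernel of [psi]. *)
Definition finite_field_separated (R : idomainType) (K : fieldType)
    (psi : {rmorphism R -> K}) : Prop :=
  forall y, psi y != 0 -> exists (F : finFieldType) (phi : {rmorphism R -> F}),
    (forall r, psi r = 0 -> phi r = 0) /\ phi y != 0.

(** In characteristic [p], reduce modulo [p]; in characteristic zero, reduce modulo a prime larger
    than the absolute value of [y]. *)
Lemma finite_field_separated_int (K : fieldType) :
  finite_field_separated (intr : {rmorphism int -> K}).
Proof.
have intr_abs (A : pzRingType) (z : int) :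
    (z%:~R == 0 :> A) = (`|z|%N%:R == 0 :> A).
  by case: z => n //=; rewrite NegzE mulrNz oppr_eq0.
move=> y y0.
have [[p pK]|K0] := pselect (exists p, p \in [pchar K]).
  have p_prime := pcharf_prime pK.
  have intr_Fp z : (z%:~R == 0 :> 'F_p) = (z%:~R == 0 :> K).
    by rewrite !intr_abs -(dvdn_pcharf pK) -(dvdn_pcharf (pchar_Fp p_prime)).
  exists 'F_p, intr; split=> [r r0|]; last by rewrite intr_Fp.
  by apply/eqP; rewrite intr_Fp r0.
have {}K0 : [pchar K] =i pred0.
  by move=> p; apply/negP => pK; apply: K0; exists p.
have [p yp p_prime] := prime_above `|y|%N.
exists 'F_p, intr; split=> [r|].
  move=> /eqP; rewrite intr_abs ((pcharf0P K).1 K0) absz_eq0 => /eqP ->.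
  by rewrite rmorph0.
move: y0; rewrite !intr_abs ((pcharf0P K).1 K0) -lt0n => y0.
by rewrite -(dvdn_pcharf (pchar_Fp p_prime)) gtnNdvd.
Qed.

Section PolyStep.
Variables (R : idomainType) (K : fieldType) (psi : {rmorphism R -> K}) (t : K).
Hypothesis psiP : finite_field_separated psi.
Notation ev := (horner_eval t \o map_poly psi : {rmorphism {poly R} -> K}).

Lemma map_poly_separated (F : finFieldType) (phi : {rmorphism R -> F})
    (r : {poly R}) :
  (forall a, psi a = 0 -> phi a = 0) ->
  map_poly psi r = 0 -> map_poly phi r = 0.
Proof.
move=> phi0 /polyP r0; apply/polyP => i; have := r0 i.
by rewrite !coef_map !coef0; exact: phi0.
Qed.

(** As [t] satisfies no relation, it may be sent anywhere: pick [phi] that keeps the leading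
    coefficient of the image of [y], then a nonroot of [map_poly phi y]. *)
Lemma finite_field_separated_transcendental :
  (forall r, ev r = 0 -> map_poly psi r = 0) -> finite_field_separated ev.
Proof.
move=> evI y y0.
have : map_poly psi y != 0.
  by apply: contra_neq y0 => /= ->; rewrite horner_evalE horner0.
rewrite -lead_coef_eq0 /lead_coef coef_map => /psiP[F [phi [phi0 phiy]]].
have /finField_ext_nonroot[F' [i [x yx]]] : map_poly phi y != 0.
  apply: contra_neq phiy => /polyP/(_ (size (map_poly psi y)).-1).
  by rewrite coef_map coef0.
exists F', (horner_eval x \o map_poly i \o map_poly phi); split=> // r /evI.
move=> /(map_poly_separated phi0) /= ->.
by rewrite rmorph0 horner_evalE horner0.
Qed.

(** Dropping the leading terms killed by [psi] makes degrees over [R] and [K] agree, so that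
    pseudo-division over [R] controls degrees over [K]. *)
Lemma map_poly_trunc (p : {poly R}) : exists2 q : {poly R},
  map_poly psi q = map_poly psi p & size q = size (map_poly psi p).
Proof.
have [k] := ubnP (size p); elim: k p => // k IH p pk.
have [p0|p0] := eqVneq (psi (lead_coef p)) 0; last first.
  by exists p => //; rewrite size_map_poly_id0.
have [->|pz] := eqVneq p 0.
  by exists 0; rewrite ?rmorph0 // !polyseq0.
have [|q qE qs] := IH (take_poly (size p).-1 p).
  by rewrite (leq_ltn_trans (size_take_poly _ _)) // prednK ?size_poly_gt0.
have tE : map_poly psi (take_poly (size p).-1 p) = map_poly psi p.
  apply/polyP => i; rewrite !coef_map coef_take_poly; case: ltnP => //.
  rewrite leq_eqVlt => /predU1P[<-|].
    exact: etrans (rmorph0 _) (esym p0).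
  by rewrite prednK ?size_poly_gt0 // => /(nth_default 0) ->.
by exists q; rewrite ?qE ?qs tE.
Qed.

Section Algebraic.
(** Up to a scalar, [p] lifts the minimal polynomial of [t] over the fraction field of the image of
    [psi]. *)
Variable p : {poly R}.
Hypotheses (p_root : ev p = 0) (p_neq0 : map_poly psi p != 0)
  (p_size : size p = size (map_poly psi p))
  (p_min : forall r, ev r = 0 ->
    (size (map_poly psi r) < size p)%N -> map_poly psi r = 0).

Let p0 : p != 0. Proof. by rewrite -size_poly_gt0 p_size size_poly_gt0. Qed.

Let lead_neq0 (r : {poly R}) :
  r != 0 -> size r = size (map_poly psi r) -> psi (lead_coef r) != 0.
Proof.
move=> r0 rs; have : lead_coef (map_poly psi r) != 0.
  by rewrite lead_coef_eq0 -size_poly_gt0 -rs size_poly_gt0.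
by rewrite /lead_coef coef_map -rs.
Qed.

Let p_size1 : (1 < size p)%N.
Proof.
rewrite ltnNge; apply/negP => /size1_polyC pE; case/negP: p_neq0.
move: p_root; rewrite pE /= map_polyC horner_evalE hornerC /= => ->.
by rewrite polyC0.
Qed.

Lemma evC c : ev c%:P = psi c.
Proof. by rewrite /= map_polyC horner_evalE hornerC. Qed.

Lemma evZ c r : ev (c *: r) = psi c * ev r.
Proof. by rewrite -mul_polyC rmorphM evC. Qed.

(* Take [r] of least degree in the ideal generated by [y] and the kernel of
   [ev], not vanishing at [t].  Its degree is less than that of [p], and if it
   were positive then dividing [p] by [r] would either lower it or factor [p]. *)
Lemma algebraic_multiple_constant y : ev y != 0 ->
  exists u c, psi c != 0 /\ ev (u * y) = psi c.
Proof.
move=> y0; pose P n := `[< exists u r, [/\ ev (u * y) = ev r, ev r != 0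
  & size (map_poly psi r) = n] >].
have exP : exists n, P n.
  by exists (size (map_poly psi y)); apply/asboolP; exists 1, y; rewrite mul1r.
have [n /asboolP[u [r' [uy r'0 r'n]]] nmin] := ex_minnP exP.
have n_le r v : ev (v * y) = ev r -> ev r != 0 -> (n <= size r)%N.
  move=> vy r0; apply: leq_trans (nmin _ _) (size_poly _ _).
  by apply/asboolP; exists v, r.
have [r rE rn] := map_poly_trunc r'; rewrite r'n in rn.
have evr : ev r = ev r' by rewrite /= rE.
rewrite -evr in uy r'0; rename r'0 into r0.
have rn0 : r != 0 by apply: contra_neq r0 => ->; rewrite rmorph0.
have lr : psi (lead_coef r) != 0 by apply: lead_neq0; rewrite // rn -r'n rE.
have lp := lead_neq0 p0 p_size.
have n_lt : (n < size p)%N.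
  have := Pdiv.Idomain.ltn_modp r p; rewrite p0; apply: leq_ltn_trans.
  have := congr1 ev (Pdiv.Idomain.divp_eq r p).
  rewrite rmorphD rmorphM p_root mulr0 add0r evZ => modE.
  apply: (n_le _ ((lead_coef p ^+ scalp r p) *: u)); last first.
    by rewrite -modE mulf_neq0 // rmorphXn expf_neq0.
  by rewrite -scalerAl evZ uy.
have [n1|n1] := leqP n 1.
  exists u, r`_0; have rC : r = (r`_0)%:P by apply: size1_polyC; rewrite rn.
  have evrC : ev r = psi r`_0 by rewrite {1}rC evC.
  by rewrite -evrC.
have := Pdiv.Idomain.divp_eq p r; set q := p %/ r; set m := p %% r => qE.
have mn : (size m < n)%N by rewrite -rn Pdiv.Idomain.ltn_modp.
have evq : ev q * ev r + ev m = 0.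
  by rewrite -rmorphM -rmorphD -qE evZ p_root mulr0.
have [m0|m0] := eqVneq (ev m) 0; last first.
  move: mn; rewrite ltnNge (@n_le _ (- q * u)) //.
  rewrite -mulrA rmorphM uy rmorphN mulNr.
  by apply/esym/eqP; rewrite -addr_eq0 addrC evq.
have q0 : ev q = 0.
  by move/eqP: evq; rewrite m0 addr0 mulf_eq0 (negPf r0) orbF => /eqP.
have pE : psi (lead_coef r) ^+ scalp p r *: map_poly psi p
    = map_poly psi q * map_poly psi r.
  have m00 : map_poly psi m = 0.
    apply: p_min => //.
    by rewrite (leq_ltn_trans (size_poly _ _)) // (ltn_trans mn).
  rewrite -rmorphXn -map_polyZ qE rmorphD rmorphM /=.
  by rewrite [X in _ + X]m00 addr0.
have lk0 : psi (lead_coef r) ^+ scalp p r != 0 by rewrite expf_neq0.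
have mq0 : map_poly psi q != 0.
  apply: contra_neq p_neq0 => mq0; move/eqP: pE.
  by rewrite mq0 mul0r scaler_eq0 (negPf lk0) => /eqP.
have := congr1 (size : {poly K} -> nat) pE.
rewrite size_scale // -p_size size_mul //; last first.
  by rewrite -size_poly_gt0 rE r'n ltnW.
rewrite rE r'n => sE; case/negP: mq0; apply/eqP/p_min => //.
by rewrite sE -ltnS prednK ?addn_gt0 ?(ltnW n1) ?orbT // -addn1 ltn_add2l.
Qed.

(** Some multiple of [y] equals a constant [c] at [t], so it suffices to keep [c]. Keeping the
    leading coefficient of [p] as well, send [t] to a root of the image of [p]; relations of [t]
    then die, since pseudo-division by [p] only multiplies them by a power of that coefficient. *)
Lemma finite_field_separated_algebraic : finite_field_separated ev.
Proof.
move=> y /algebraic_multiple_constant[u [c [c0 uy]]].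
have lp := lead_neq0 p0 p_size.
have /psiP[F [phi [phi0]]] : psi (lead_coef p * c) != 0.
  by rewrite rmorphM mulf_neq0.
rewrite rmorphM mulf_eq0 negb_or => /andP[phil phic].
have [F' [i [x px]]] : exists (F' : finFieldType) (i : {rmorphism F -> F'}) x,
    (map_poly i (map_poly phi p)).[x] = 0.
  by apply: finField_ext_root; rewrite size_map_poly_id0.
pose phi' : {rmorphism {poly R} -> F'} :=
  (horner_eval x \o map_poly i \o map_poly phi).
have phi'0 r : ev r = 0 -> phi' r = 0.
  move=> r0; have := Pdiv.Idomain.divp_eq r p.
  set q := r %/ p; set m := r %% p => qE.
  have m0 : map_poly psi m = 0.
    apply: p_min; last first.
      by rewrite (leq_ltn_trans (size_poly _ _)) ?Pdiv.Idomain.ltn_modp.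
    have := congr1 ev qE.
    by rewrite evZ r0 mulr0 rmorphD rmorphM p_root mulr0 add0r.
  have phi'm : phi' m = 0.
    rewrite /phi' /= (map_poly_separated phi0 m0) rmorph0.
    by rewrite horner_evalE horner0.
  have := congr1 phi' qE; rewrite rmorphD rmorphM phi'm addr0.
  rewrite [phi' p]px mulr0 -mul_polyC rmorphM => /eqP.
  rewrite mulf_eq0 => /orP[|/eqP //].
  rewrite /phi' /= !map_polyC horner_evalE hornerC /= fmorph_eq0 rmorphXn.
  by rewrite expf_eq0 (negPf phil) andbF.
exists F', phi'; split => //.
have : phi' (u * y - c%:P) = 0 by apply: phi'0; rewrite rmorphB evC uy subrr.
apply: contra_eq_neq => phiy; rewrite rmorphB rmorphM phiy mulr0 sub0r.
by rewrite oppr_eq0 /phi' /= !map_polyC horner_evalE hornerC fmorph_eq0.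
Qed.
End Algebraic.

Lemma finite_field_separated_poly : finite_field_separated ev.
Proof.
have [evI|] := pselect (forall r, ev r = 0 -> map_poly psi r = 0).
  exact: finite_field_separated_transcendental.
move=> /existsNP[p1 /not_implyP[p1_root /eqP p10]].
pose P n := `[< exists r, [/\ ev r = 0, map_poly psi r != 0
  & size (map_poly psi r) = n] >].
have exP : exists n, P n.
  by exists (size (map_poly psi p1)); apply/asboolP; exists p1.
have [n /asboolP[p' [p'_root p'0 p'n]] nmin] := ex_minnP exP.
have [p pE ps] := map_poly_trunc p'.
apply: (@finite_field_separated_algebraic p); rewrite ?ps ?pE //.
  by rewrite -p'_root /= pE.
move=> r r0; rewrite p'n ltnNge; apply: contraNeq => mr0.
by apply: nmin; apply/asboolP; exists r.
Qed.
End PolyStep.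

Lemma finite_field_separated_seq (K : fieldType) (s : seq K) :
  exists (R : idomainType) (psi : {rmorphism R -> K}),
    finite_field_separated psi /\ {in s, forall x, exists r, psi r = x}.
Proof.
elim: s => [|t s [R [psi [psiP IH]]]].
  by exists int, intr; split=> //; exact: finite_field_separated_int.
exists {poly R}, (horner_eval t \o map_poly psi); split.
  exact: finite_field_separated_poly.
move=> x; rewrite inE => /predU1P[->|/IH[r <-]].
  by exists 'X; rewrite /= map_polyX horner_evalE hornerX.
by exists r%:P; rewrite /= map_polyC horner_evalE hornerC.
Qed.

(** * Malcev's theorem *)

Lemma subgroup_generated_ind (G : groupType) (A H : set G) :
  group_closed (mem H) -> (forall x, A x -> H x) ->
  forall x, subgroup_generated A x -> H x.
Proof. by move=> Hg AH x; apply; split. Qed.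

Lemma map_mx_lift (R : nzRingType) (K : nzRingType) (psi : R -> K) m n
    (M : 'M[K]_(m, n)) :
  (forall i j, exists r, psi r = M i j) -> exists N, map_mx psi N = M.
Proof.
move=> MP; exists (\matrix_(i, j) sval (cid (MP i j))).
by apply/matrixP => i j; rewrite !mxE; exact: svalP (cid (MP i j)).
Qed.

Lemma finite_field_separated_mx (R : idomainType) (K : fieldType)
    (psi : {rmorphism R -> K}) (F : finFieldType) (phi : {rmorphism R -> F}) m n
    (M N : 'M[R]_(m, n)) : (forall r, psi r = 0 -> phi r = 0) ->
  map_mx psi M = map_mx psi N -> map_mx phi M = map_mx phi N.
Proof.
move=> phi0 /matrixP MN; apply/matrixP => i j; have := MN i j; rewrite !mxE.
move=> /eqP; rewrite -subr_eq0 -rmorphB => /eqP/phi0/eqP.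
by rewrite rmorphB subr_eq0 => /eqP.
Qed.

(** The entries of the generators and their inverses lie in a finitely generated domain; mapping it
    to a finite field while keeping apart one entry of [f g] and [f 1] gives a finite quotient where
    [g] survives. *)
Theorem linear_residually_finite (G : groupType) :
  finitely_generated G -> linear_group G -> residually_finite G.
Proof.
move=> [A /finite_seqP[s ->] sG] [[|n] [k [f [f_inj f_unit fM]]]] g g1.
  by case: g1; apply: f_inj; rewrite [LHS]thinmx0 [RHS]thinmx0.
have f1 : f 1%g = 1%:M.
  have := fM 1%g 1%g; rewrite mulg1 => /(congr1 (mulmx (invmx (f 1%g)))).
  by rewrite mulmxA mulVmx // mul1mx.
pose entries (M : 'M[k]_n.+1) := [seq M ij.1 ij.2 | ij : 'I_n.+1 * 'I_n.+1].
have [R [psi [psiP imP]]] := finite_field_separated_seq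
  (flatten [seq entries (f h) ++ entries (f h^-1%g) | h <- s]).
(* Recording the inverse too makes [H] closed under division. *)
pose H : set G := fun h => (exists M, map_mx psi M = f h) /\
  (exists M, map_mx psi M = f h^-1%g).
have HG h : H h.
  have : [set: G]%classic h by [].
  rewrite -sG; apply: subgroup_generated_ind => [|{}h /= hs].
    split=> [|u v /set_mem[[Mu uE] [Nu u'E]] /set_mem[[Mv vE] [Nv v'E]]];
      apply/mem_set.
      by split; exists 1%:M; rewrite ?invg1 f1 map_mx1.
    split; [exists (Mu *m Nv)|exists (Mv *m Nu)]; rewrite map_mxM ?invgF fM.
      by rewrite uE v'E.
    by rewrite u'E vE.
  have im (M : 'M[k]_n.+1) i j :
      entries M \in [:: entries (f h); entries (f h^-1%g)] ->
      exists r, psi r = M i j.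
    move=> hM; apply: imP; apply/flattenP.
    exists (entries (f h) ++ entries (f h^-1%g)); first exact: map_f.
    have : M i j \in entries M by apply/codomP; exists (i, j).
    by move: hM; rewrite !inE mem_cat => /orP[] /eqP <- ->; rewrite ?orbT.
  by split; apply: map_mx_lift => i j; apply: im; rewrite !inE eqxx ?orbT.
pose lift h := sval (cid (HG h).1).
have liftE h : map_mx psi (lift h) = f h by exact: svalP (cid (HG h).1).
have [i [j gij]] : exists i j, f g i j != f 1%g i j.
  apply/not_existsP => nij; apply: g1; apply: f_inj; apply/matrixP => i j.
  apply/eqP/negPn/negP => ij; apply: (nij i); by exists j.
have [|F [phi [phi0 phi_g]]] := psiP (lift g i j - lift 1%g i j).
  by move: gij; rewrite -!liftE !mxE rmorphB subr_eq0.
pose Phi h := map_mx phi (lift h).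
have PhiM h h' : Phi (h * h')%g = Phi h *m Phi h'.
  rewrite -map_mxM; apply: (finite_field_separated_mx phi0).
  by rewrite map_mxM !liftE fM.
have Phi1 : Phi 1%g = 1%:M.
  rewrite -(map_mx1 phi); apply: (finite_field_separated_mx phi0).
  by rewrite liftE f1 map_mx1.
have PhiU h : Phi h \is a GRing.unit.
  by have := PhiM h h^-1%g; rewrite mulgV Phi1 => /esym/mulmx1_unit[].
pose theta h : {'GL_n.+1[F]} := FinRing.Unit (PhiU h).
have thetaM : {morph theta : x y / (x * y)%g} by move=> x y; exact/val_inj/PhiM.
pose m := isMultiplicative.Build _ _ theta thetaM.
pose thetam := HB.pack_for {multiplicative G -> {'GL_n.+1[F]}} theta m.
exists {'GL_n.+1[F]}, thetam => /(congr1 val)/= ggE.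
case/negP: phi_g; rewrite rmorphB subr_eq0; apply/eqP.
have : Phi g = Phi 1%g by rewrite Phi1.
by move=> /matrixP/(_ i j); rewrite !mxE.
Qed.

(** * Commutators, supports and finite quotients *)

Section Multiplicative.
Local Open Scope group_scope.
Variables (G H : groupType) (f : {multiplicative G -> H}).

Lemma multiplicative1 : f 1 = 1.
Proof. by apply: (mulgI (f 1)); rewrite -gmulfM !mulg1. Qed.

Lemma multiplicativeV x : f x^-1 = (f x)^-1.
Proof. by apply: (mulgI (f x)); rewrite -gmulfM !mulgV multiplicative1. Qed.

(** Under [f], the conjugate of [x^-1] by [n] becomes [(f x)^-1], so [f y] commutes with [f x]. *)
Lemma commutator_kernel n x y : f n = 1 -> commute y (n * x^-1 * n^-1) ->
  f [~ x, y] = 1.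
Proof.
move=> fn /(gmulf_commute f).
rewrite !gmulfM !multiplicativeV fn invg1 mulg1 mul1g.
by move=> /commuteV; rewrite invgK => /commute_sym/commgP/eqP.
Qed.
End Multiplicative.

Section MicroSupported.
Local Open Scope group_scope.
Variables (G : groupType) (X : topologicalType) (act : G -> X -> X).
Hypotheses (act1 : forall x, act 1 x = x)
  (actM : forall g h x, act (g * h) x = act g (act h x))
  (act_faithful : faithful_action act).
Hypothesis displace : forall g x, act g x <> x ->
  exists2 V, nbhs x V & forall y, V y -> ~ V (act g y).
(** This is extreme proximality of the action. *)
Hypothesis compress : forall (x y : X) (U V : set X), nbhs x U -> nbhs y V ->
  exists h, forall z, ~ U z -> V (act h z).

Definition supported (V : set X) g := forall x, ~ V x -> act g x = x.

Lemma supported_conj g h (V W : set X) :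
  (forall x, ~ W x -> ~ V (act h^-1 x)) ->
  supported V g -> supported W (h * g * h^-1).
Proof. by move=> WV Vg x /WV nV; rewrite !actM Vg // -actM mulgV act1. Qed.

Lemma act_inj g : injective (act g).
Proof. by apply: (can_inj (g := act g^-1)) => x; rewrite -actM mulVg act1. Qed.

Lemma act_ext g h : (forall x, act g x = act h x) -> g = h.
Proof.
move=> gh; rewrite -[g](mulgVK h) (act_faithful (g := g * h^-1)) ?mul1g // => x.
by rewrite actM gh -actM mulgV act1.
Qed.

(** By injectivity, a point moved by one element is sent to a point of the same support, and the
    other element fixes both. *)
Lemma disjoint_commute g h (V W : set X) : (forall x, V x -> ~ W x) ->
  supported V g -> supported W h -> commute g h.
Proof.
have stay (V' W' : set X) k k' x : (forall x, V' x -> ~ W' x) ->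
    supported V' k -> supported W' k' -> act k x <> x ->
    act k (act k' x) = act k' (act k x).
  move=> VW Vk Wk' kx; have Vx : V' x by apply: contrapT => /Vk.
  have Vkx : V' (act k x).
    by apply: contrapT => /Vk/(@act_inj k).
  by rewrite !Wk'//; exact: VW.
move=> VW Vg Wh; apply: act_ext => x; rewrite !actM.
have [gx|gx] := pselect (act g x = x); last exact: (stay V W).
have [hx|hx] := pselect (act h x = x); first by rewrite !(gx, hx).
by symmetry; apply: (stay W V) => // y Wy Vy; exact: (VW y).
Qed.

Lemma residually_finite_topologically_free :
  residually_finite G ->
  (forall (Q : finGroupType) (f : {multiplicative G -> Q}), ~ injective f) ->
  topologically_free act.
Proof.
move=> rfG infG g g1; apply/eqP; apply/negPn/negP => /set0P[x0].
rewrite /interior; set U := [set x | _] => Ux0.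
have moved k : k <> 1 -> exists x, act k x <> x.
  by move=> k1; apply/existsNP => kx; exact/k1/act_faithful.
have push (x : X) (V : set X) : nbhs x V -> exists h, forall k,
    supported (~` U) k -> supported V (h * k * h^-1).
  move=> xV; have [h hV] := compress Ux0 xV; exists h => k kU.
  apply: supported_conj kU => y nV /= nU; apply: nV; have := hV _ nU.
  by rewrite -actM mulgV act1.
have gU : supported (~` U) g by move=> x /contrapT.
have [x1 gx1] := moved g g1.
have [V x1V gV] := displace gx1; have [h hP] := push _ _ x1V.
pose w := h * g * h^-1; have wV : supported V w by exact: hP.
(* [U] and [V] are disjoint: [g] fixes the points of [U] and moves those of [V] out of [V]. *)
have wU : supported (~` U) w.
  move=> x /contrapT Ux; apply: wV => Vx; apply: (gV _ Vx).
  by rewrite (Ux : act g x = x).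
(* At a point [x] moved by [w], commuting would give [g (w x) = w (g x) = g x], as [g x] is outside
   [V]. *)
have gw : [~ g, w] <> 1.
  move=> /eqP/commgP; rewrite /commute => gw.
  have [|x wx] := moved w.
    move=> w1; apply: g1; apply: (mulgI h); apply: (mulIg h^-1).
    by rewrite mulg1 mulgV.
  have Vx : V x by apply: contrapT => /wV.
  apply: wx; apply: (@act_inj g); rewrite -actM gw actM wV //.
  exact: gV.
have [Q [f fgw]] := rfG _ gw; apply: (infG Q f).
suff ker n : f n = 1 -> n = 1.
  move=> x y fxy; apply/divg1_eq/ker.
  by rewrite gmulfM multiplicativeV fxy mulgV.
move=> fn; apply: contrapT => /moved[x2 nx2].
have [V' x2V nV] := displace nx2; have [h' h'P] := push _ _ x2V.
pose x := h' * g * h'^-1; pose y := h' * w * h'^-1.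
have xV : supported V' x by exact: h'P.
have yV : supported V' y by exact: h'P.
have nxV : supported (act n @` V') (n * x^-1 * n^-1).
  apply: (supported_conj (V := V')) => [z nz Vz|z Vz].
    by apply: nz; exists (act n^-1 z) => //; rewrite -actM mulgV act1.
  by apply: (@act_inj x); rewrite -actM mulgV act1 xV.
have ynx : commute y (n * x^-1 * n^-1).
  apply: disjoint_commute yV nxV => z Vz [t Vt tz].
  by apply: (nV t) => //; rewrite tz.
have conjK z : (h' * z * h'^-1) ^ h' = z.
  by rewrite conjgE !mulgA mulVg mul1g mulgVK.
apply: fgw; rewrite -(conjK g) -(conjK w) -conjRg -/x -/y conjgE.
rewrite gmulfM [f (_ * h')]gmulfM.
by rewrite (commutator_kernel fn ynx) mul1g -gmulfM mulVg multiplicative1.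
Qed.
End MicroSupported.

(** * Gromov products under the four-point inequality *)

Definition four_point (R : realType) (S : metricType R) (d : R) : Prop :=
  forall s t u o : S,
    Num.min (gromov_product o s u) (gromov_product o u t) - d
      <= gromov_product o s t.

Section GromovProductTheory.
Context {R : realType} {S : metricType R}.
Implicit Types (o s t x y p q : S).

Lemma gromov_product_add s t x :
  gromov_product t s x + gromov_product s t x = mdist s t.
Proof. by rewrite /gromov_product (metric_sym t) !(metric_sym x); lra. Qed.

Lemma gromov_product_lip o s s' t :
  gromov_product o s t <= gromov_product o s' t + mdist s s'.
Proof.
have := metric_triangle s s' o; have := metric_triangle s' s t.
by rewrite (metric_sym s' s) /gromov_product; lra.
Qed.

Lemma gromov_product_le_mdist o s t : gromov_product o s t <= mdist o s.
Proof.
have := metric_triangle o s t.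
by rewrite /gromov_product (metric_sym s o) (metric_sym t o); lra.
Qed.

Variable d : R.
Hypothesis hyp : four_point S d.

(** As a disjunction, hyperbolicity reduces estimates to linear arithmetic by cases. *)
Lemma gromov_product_or o s u t :
  gromov_product o s u <= gromov_product o s t + d
  \/ gromov_product o u t <= gromov_product o s t + d.
Proof.
have := hyp s t u o; rewrite lerBlDr ge_min => /orP[]; by [left|right].
Qed.

(* [s] and [t] are both coarse centers of the triangle [x p q].  At most one of
   [x], [p], [q] is seen from [s] in the direction of [t], and the other two are
   then seen from [t] in the common direction of [s]. *)
Lemma mdist_tripod_centers M s t x p q : 0 <= d ->
  gromov_product s x p <= M -> gromov_product s x q <= M ->
  gromov_product s p q <= M -> gromov_product t x p <= M ->
  gromov_product t x q <= M -> gromov_product t p q <= M ->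
  mdist s t <= M + M + d + d.
Proof.
move=> d0 sxp sxq spq txp txq tpq.
have sx := gromov_product_add s t x; have sp := gromov_product_add s t p.
have sq := gromov_product_add s t q.
have := gromov_product_or s x t p; have := gromov_product_or s x t q.
have := gromov_product_or s p t q; have := gromov_product_or t x s p.
have := gromov_product_or t x s q; have := gromov_product_or t p s q.
rewrite !(gromov_productC _ _ s) !(gromov_productC _ _ t).
by move=> [?|?] [?|?] [?|?] [?|?] [?|?] [?|?]; lra.
Qed.

End GromovProductTheory.

(** * Sequences converging to boundary points *)

Section Boundary.
Context {R : realType} {S : metricType R}.
Hypothesis hypS : hyperbolic_space S.
Implicit Types (o s t : S) (x y z : nat -> S) (p q : boundary S).

Lemma asymptotic_at s x y :
  (forall M, exists N, forall i j, (N <= i)%N -> (N <= j)%N ->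
    M <= gromov_product s (x i) (y j)) -> asymptotic x y.
Proof.
move=> xy; apply/asymptoticP => o M; have [N NM] := xy (M + mdist s o).
exists N => i j Ni Nj; have := NM i j Ni Nj.
by have := gromov_product_base s o (x i) (y j); lra.
Qed.

Lemma converges_to_at_infinity x p :
  converges_to x p -> converges_at_infinity x.
Proof. by case: p => A [z zz eqA]; rewrite /converges_to /= eqA => -[]. Qed.

Lemma asymptotic_converges_to x y p :
  converges_to x p -> asymptotic x y -> converges_to y p.
Proof.
case: p => A [z zz eqA]; rewrite /converges_to /= eqA => -[xx zx] xy; split.
  exact: (asymptotic_trans hypS (asymptotic_sym xy) xy).
exact: (asymptotic_trans hypS zx xy).
Qed.

Lemma converges_to_inj x p q : converges_to x p -> converges_to x q -> p = q.
Proof.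
move=> xp xq; have pq y : sval p y <-> sval q y.
  split=> [yp|yq].
    apply: (asymptotic_converges_to xq).
    exact: (converges_to_asymptotic hypS xp yp).
  apply: (asymptotic_converges_to xp).
  exact: (converges_to_asymptotic hypS xq yq).
apply: eq_sig_hprop => [? ? ?|]; first exact: Prop_irrelevance.
by apply/funext => y; exact/propext/pq.
Qed.

(** Otherwise large products occur at arbitrarily late indices [i]; hyperbolicity spreads each to
    all late pairs [k], [l], and the two limits coincide. *)
Lemma boundary_neq_bounded s x y p q : p <> q ->
  converges_to x p -> converges_to y q ->
  exists2 M, 0 <= M & \forall n \near \oo, gromov_product s (x n) (y n) <= M.
Proof.
move=> pq xp yq; apply: contrapT => unb; apply: pq.
apply: (converges_to_inj _ yq); apply: (asymptotic_converges_to xp).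
have [_ [d d0 hyp]] := hypS.
apply: (asymptotic_at (s := s)) => M.
have /asymptoticP/(_ s (M + d + d))[N xN] := converges_to_at_infinity xp.
have /asymptoticP/(_ s (M + d + d))[N' yN] := converges_to_at_infinity yq.
have [i Ni ij] : exists2 i, (maxn N N' <= i)%N &
    M + d + d < gromov_product s (x i) (y i).
  apply: contrapT => nij; apply: unb; exists (Num.max 0 (M + d + d)).
    by rewrite le_max lexx.
  exists (maxn N N') => // i /= Ni; rewrite le_max orbC leNgt; apply/orP; left.
  by apply/negP => ij; apply: nij; exists i.
move: Ni; rewrite geq_max => /andP[Ni N'i].
exists (maxn N N') => k l; rewrite !geq_max => /andP[Nk _] /andP[_ N'l].
have := xN k i Nk Ni; have := yN i l N'i N'l.
have := gromov_product_or hyp s (x k) (x i) (y l).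
by have := gromov_product_or hyp s (x i) (y i) (y l); move=> [?|?] [?|?]; lra.
Qed.

End Boundary.

(** * Isometries and their action on the boundary *)

Section Action.
Context {G : groupType} {R : realType} {S : metricType R}.
Variable a : isometric_action G S.
Hypothesis hypS : hyperbolic_space S.
Implicit Types (g h : G) (s t : S) (p q : boundary S).

Lemma mdist_iactV g s t : mdist (a g^-1%g s) t = mdist s (a g t).
Proof. by rewrite -(iact_isometry a g) iactVK. Qed.

Lemma gromov_product_iactV g o s t :
  gromov_product (a g^-1%g o) s t = gromov_product o (a g s) (a g t).
Proof. by rewrite -(iact_gromov_product a g) iactVK. Qed.

Lemma converges_to_iact g x p :
  converges_to x p -> converges_to (a g \o x) (iact_boundary a g p).
Proof. by move=> xp; exists x. Qed.

Lemma iact_boundary1 p : iact_boundary a 1%g p = p.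
Proof.
have [x xp] := converges_to_ex p; apply: (converges_to_inj hypS _ xp).
have <- : a 1%g \o x = x by apply/funext => i /=; rewrite iact1.
exact: converges_to_iact.
Qed.

Lemma iact_boundaryM g h p :
  iact_boundary a (g * h)%g p = iact_boundary a g (iact_boundary a h p).
Proof.
have [x xp] := converges_to_ex p.
apply: (converges_to_inj hypS (converges_to_iact (g * h) xp)).
have -> : a (g * h)%g \o x = a g \o (a h \o x).
  by apply/funext => i /=; rewrite iactM.
exact/converges_to_iact/converges_to_iact.
Qed.

(** All of the subgroup generated by [g] fixes both ends, and a quotient of two of its elements with
    distant orbit points moves [s] far. *)
Lemma loxodromic_far s g : loxodromic a g -> exists p q, [/\ p <> q,
  fixed_boundary a g = [set p; q] & forall M, exists h,
    [/\ M < mdist s (a h s), iact_boundary a h p = p &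
      iact_boundary a h q = q]].
Proof.
move=> [unb [p [q [pq fix_pq]]]]; exists p, q; split=> // M.
have fixVM r u v : iact_boundary a u r = r -> iact_boundary a v r = r ->
    iact_boundary a (u * v^-1)%g r = r.
  by move=> ur vr; rewrite -{1}vr -iact_boundaryM mulgVK.
have [_ [_ [[h hg <-] [k kg <-] Mhk]]] := unb s M.
have fixed : forall u, subgroup_generated [set g] u ->
    [set u | iact_boundary a u p = p /\ iact_boundary a u q = q] u.
  apply: subgroup_generated_ind => [|u ->]; last first.
    have : [set p; q] p by left.
    have : [set p; q] q by right.
    by rewrite -fix_pq.
  split=> [|u v /set_mem[up uq] /set_mem[vp vq]]; apply/mem_set.
    by split; exact: iact_boundary1.
  by split; exact: fixVM.
have [hp hq] := fixed _ hg; have [kp kq] := fixed _ kg.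
exists (h^-1 * k)%g; rewrite iactM -mdist_iactV invgK; split=> //.
  by rewrite -[in RHS](iact_boundary1 p) -(mulVg h) !iact_boundaryM hp kp.
by rewrite -[in RHS](iact_boundary1 q) -(mulVg h) !iact_boundaryM hq kq.
Qed.

(* If [x] sees neither of the ends [p], [q] of [g], then the isometry [g],
   moving [s] far and [p], [q] little, must move the direction of [x]. *)
Lemma gromov_product_iact_or (d M : R) (g : G) (s x p q : S) :
  0 <= d -> four_point S d ->
  gromov_product s p q <= M ->
  M + d + d + d < gromov_product s (a g p) p ->
  M + d + d + d < gromov_product s (a g q) q ->
  M + M + d *+ 10 < mdist s (a g s) ->
  [\/ gromov_product s x (a g x) <= M + d + d, M < gromov_product s x p
    | M < gromov_product s x q].
Proof.
move=> d0 hyp pq gp gq far.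
have [xgx|xgx] := leP (gromov_product s x (a g x)) (M + d + d).
  by constructor 1.
have [xp|xp] := ltP M (gromov_product s x p); first by constructor 2.
have [xq|xq] := ltP M (gromov_product s x q); first by constructor 3.
exfalso.
have moved y z : gromov_product s y z <= M ->
    M + d + d < gromov_product s y (a g y) ->
    M + d + d + d < gromov_product s (a g z) z ->
    gromov_product s (a g y) (a g z) <= M + d + d.
  move=> yz ygy gz; have := gromov_product_or hyp s y (a g y) z.
  have := gromov_product_or hyp s (a g y) (a g z) z.
  by move=> [?|?] [?|?]; lra.
have gpp : M + d + d < gromov_product s p (a g p).
  by rewrite gromov_productC; lra.
(* Products of [x], [p], [q] seen from [g^-1 s] are those of their images under [g] seen from [s],
   so both points are coarse centers of one triangle, yet too far apart. *)
have := mdist_tripod_centers (M := M + d + d) (s := s) (t := a g^-1%g s)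
  (x := x) (p := p) (q := q) hyp d0.
rewrite !gromov_product_iactV metric_sym mdist_iactV !moved //.
by move=> /(_ _ _ _ erefl erefl erefl); lra.
Qed.

Lemma fixed_sequence s g p x : iact_boundary a g p = p -> converges_to x p ->
  forall M, \forall n \near \oo, M <= gromov_product s (a g (x n)) (x n).
Proof.
move=> gp xp M; have := converges_to_iact g xp; rewrite gp => gxp.
have /asymptoticP/(_ s M)[N NM] := converges_to_asymptotic hypS gxp xp.
by exists N => // i /= Ni; exact: NM.
Qed.

(** The direction of [x] cannot be close both to an end of [g] and to an end of [g'], so some [e]
    moving [s] far and fixing one pair of ends separates [x] from [e x]. Then [y] is close to at
    most one of these, and [1] or [e] serves. *)
Lemma general_type_scatter s : general_type a -> exists C, forall x y, exists c,
  gromov_product s (a c x) y <= C /\ mdist s (a c s) <= C.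
Proof.
move=> [_ [g [g' [/(loxodromic_far s)[p [q [pq gpq far]]]
  /(loxodromic_far s)[p' [q' [pq' gpq' far']]] disj]]]].
have neq r r' : [set p; q] r -> [set p'; q'] r' -> r <> r'.
  rewrite -gpq -gpq' => gr gr' rr'; rewrite -rr' in gr'.
  by rewrite -[False]/(set0 r) -disj.
have pp' : p <> p' by apply: neq; left.
have pq'' : p <> q' by apply: neq; [left|right].
have qp' : q <> p' by apply: neq; [right|left].
have qq' : q <> q' by apply: neq; right.
have [_ [d d0 hyp]] := hypS.
have [P Pp] := converges_to_ex p; have [Q Qq] := converges_to_ex q.
have [P' Pp'] := converges_to_ex p'; have [Q' Qq'] := converges_to_ex q'.
have [M1 M1_ge0 b1] := boundary_neq_bounded hypS s pq Pp Qq.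
have [M2 M2_ge0 b2] := boundary_neq_bounded hypS s pq' Pp' Qq'.
have [M3 M3_ge0 b3] := boundary_neq_bounded hypS s pp' Pp Pp'.
have [M4 M4_ge0 b4] := boundary_neq_bounded hypS s pq'' Pp Qq'.
have [M5 M5_ge0 b5] := boundary_neq_bounded hypS s qp' Qq Pp'.
have [M6 M6_ge0 b6] := boundary_neq_bounded hypS s qq' Qq Qq'.
(* Above each of the six bounds, with a spare [d] for the loss in [sep]. *)
pose M := M1 + M2 + M3 + M4 + M5 + M6 + d.
have [c [cs cp cq]] := far (M + M + d *+ 10).
have [c' [cs' cp' cq']] := far' (M + M + d *+ 10).
have e1 := fixed_sequence s cp Pp (M + d + d + d + 1).
have e2 := fixed_sequence s cq Qq (M + d + d + d + 1).
have e3 := fixed_sequence s cp' Pp' (M + d + d + d + 1).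
have e4 := fixed_sequence s cq' Qq' (M + d + d + d + 1).
(* From here on, points of [S] far along the sequences stand in for the four ends. *)
near \oo => n.
pose C := M + d + d + d + mdist s (a c s) + mdist s (a c' s).
exists C => x y.
have m0 := mdist_ge0 s (a c s); have m0' := mdist_ge0 s (a c' s).
have mss : mdist s s = 0 by rewrite mdistxx.
have reduce e : gromov_product s x (a e x) <= M + d + d ->
    mdist s (a e s) <= mdist s (a c s) + mdist s (a c' s) ->
    exists c0, gromov_product s (a c0 x) y <= C /\ mdist s (a c0 s) <= C.
  move=> xex es; have := gromov_product_or hyp s x y (a e x).
  rewrite (gromov_productC _ y) => -[?|?];
    [exists 1%g; rewrite !iact1|exists e]; by rewrite /C /M; lra.
have sep u v : M < gromov_product s x u -> M < gromov_product s x v ->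
    M - d < gromov_product s u v.
  move=> xu xv; have := gromov_product_or hyp s u x v.
  by rewrite (gromov_productC s u x) => -[?|?]; lra.
have [|||xcx|xp|xq] :=
  @gromov_product_iact_or d M c s x (P n) (Q n) d0 hyp _ _ _ cs.
- by near: n; apply: filterS b1 => k; rewrite /M; lra.
- by near: n; apply: filterS e1 => k; lra.
- by near: n; apply: filterS e2 => k; lra.
- by apply: (reduce c) => //; lra.
all: have [|||xcx'|xp'|xq'] :=
  @gromov_product_iact_or d M c' s x (P' n) (Q' n) d0 hyp _ _ _ cs'.
all: try by apply: (reduce c') => //; lra.
all: try by near: n; apply: filterS b2 => k; rewrite /M; lra.
all: try by near: n; apply: filterS e3 => k; lra.
all: try by near: n; apply: filterS e4 => k; lra.
all: exfalso.
- have := sep _ _ xp xp'; apply/negP; rewrite -leNgt.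
  by near: n; apply: filterS b3 => k; rewrite /M; lra.
- have := sep _ _ xp xq'; apply/negP; rewrite -leNgt.
  by near: n; apply: filterS b4 => k; rewrite /M; lra.
- have := sep _ _ xq xp'; apply/negP; rewrite -leNgt.
  by near: n; apply: filterS b5 => k; rewrite /M; lra.
- have := sep _ _ xq xq'; apply/negP; rewrite -leNgt.
  by near: n; apply: filterS b6 => k; rewrite /M; lra.
Unshelve. all: by end_near.
Qed.
(** One large product at late indices controls all late terms of any sequences with the same limits,
    at the cost of one [d] on each side. *)
Lemma boundary_product_frequently (d : R) s p q (r : R) x y :
  four_point S d -> 0 <= d -> converges_to x p -> converges_to y q ->
  (forall N, exists i j, [/\ (N <= i)%N, (N <= j)%N &
    r + d + d <= gromov_product s (x i) (y j)]) ->
  (r%:E <= boundary_product s p q)%E.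
Proof.
move=> hyp d0 xp yq freq; apply: boundary_product_ge => x' y' x'p y'q.
have /asymptoticP/(_ s (r + d + d))[N1 x'x] :=
  converges_to_asymptotic hypS x'p xp.
have /asymptoticP/(_ s (r + d + d))[N2 yy'] :=
  converges_to_asymptotic hypS yq y'q.
have [i [j []]] := freq (maxn N1 N2).
rewrite !geq_max => /andP[N1i _] /andP[_ N2j] xy.
exists (maxn N1 N2) => k l; rewrite !geq_max => /andP[N1k _] /andP[_ N2l].
have := x'x k i N1k N1i; have := yy' j l N2j N2l.
have := gromov_product_or hyp s (x' k) (x i) (y' l).
by have := gromov_product_or hyp s (x i) (y j) (y' l); move=> [?|?] [?|?]; lra.
Qed.

Lemma limit_set_orbit p s : limit_set a p ->
  exists u : nat -> G, converges_to (fun i => a (u i) s) p.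
Proof.
move=> [t [u up]]; exists u; apply: (asymptotic_converges_to hypS up).
apply: (asymptotic_at (s := s)) => M.
have /asymptoticP/(_ s (M + mdist t s))[N NM] := converges_to_at_infinity up.
exists N => i j Ni Nj; have := NM i j Ni Nj.
have := gromov_product_lip s (a (u j) t) (a (u j) s) (a (u i) t).
by rewrite iact_isometry !(gromov_productC _ _ (a (u i) t)); lra.
Qed.

(** If [q] and [g q] were both close to [p], then [g q] would be close to both [p] and [g p], which
    are apart. In [r], [d] pays for this comparison and the distance for moving the base point by
    [g]. *)
Lemma boundary_displace g p : iact_boundary a g p <> p ->
  exists2 V, nbhs p V & forall q, V q -> ~ V (iact_boundary a g q).
Proof.
have [x xp] := converges_to_ex p; have s := x 0%N.
have [_ [d d0 hyp]] := hypS.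
move=> /nesym /(boundary_neq_bounded hypS s)/(_ xp (converges_to_iact g xp)).
move=> [M M0 xgx]; pose r := M + 1 + d + mdist s (a g^-1%g s).
exists (boundary_nbhd s p r).
  apply/(nbhs_boundaryP hypS s); exists r => //.
  by rewrite !addr_ge0 ?mdist_ge0.
move=> q pq pgq; have [z zq] := converges_to_ex q.
have [N1 xz] := boundary_product_gt pq xp zq.
have [N2 xgz] := boundary_product_gt pgq xp (converges_to_iact g zq).
near \oo => n.
have N1n : (N1 <= n)%N by near: n; exists N1.
have N2n : (N2 <= n)%N by near: n; exists N2.
have : gromov_product s (x n) (a g (x n)) <= M by near: n.
apply/negP; rewrite -ltNge.
have := xz n n N1n N1n; have /= := xgz n n N2n N2n; rewrite /r.
have := gromov_product_base s (a g^-1%g s) (x n) (z n).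
rewrite gromov_product_iactV => ? ? ?.
have := gromov_product_or hyp s (x n) (a g (z n)) (a g (x n)).
rewrite (gromov_productC s (a g (z n)) (a g (x n))).
have := mdist_ge0 s (a g^-1%g s).
by move=> ? [?|?]; lra.
Unshelve. all: by end_near.
Qed.

Lemma boundary_compress p q U V :
  general_type a -> limit_set a p -> limit_set a q ->
  nbhs p U -> nbhs q V -> exists h, forall b, ~ U b -> V (iact_boundary a h b).
Proof.
move=> gt lp lq; have [x _] := converges_to_ex p; pose s := x 0%N.
have [u up] := limit_set_orbit s lp; have [v vq] := limit_set_orbit s lq.
have [C CP] := general_type_scatter s gt.
have [_ [d d0 hyp]] := hypS.
move=> /(nbhs_boundaryP hypS s)[r r0 rU] /(nbhs_boundaryP hypS s)[r' r'0 rV].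
(* Two [d] are spent going from [u i s] via [u N1 s] and [h^-1 s] to [z j], two in
   [boundary_product_frequently]; the [1] makes the inequality strict. *)
pose K := r + 1 + d *+ 4.
have /asymptoticP/(_ s (K + C + C))[N1 uK] := converges_to_at_infinity up.
have /asymptoticP/(_ s (r' + 1 + d *+ 4 + C + K))[N2 vK] :=
  converges_to_at_infinity vq.
have {}uK i (N1i : (N1 <= i)%N) := uK i N1 N1i (leqnn N1).
have {}vK i (N2i : (N2 <= i)%N) := vK i N2 N2i (leqnn N2).
have [c [cuv cs]] := CP (a (u N1)^-1%g s) (a (v N2)^-1%g s).
have C0 : 0 <= C := le_trans (mdist_ge0 _ _) cs.
pose h := (v N2 * (c * (u N1)^-1))%g.
(* Seen from [s], the product of [v s] and [h s] is [mdist s (v s)] minus that of [v^-1 s] and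
   [c u^-1 s], which is at most [C]. *)
have hs : r' + 1 + d *+ 4 + K <= gromov_product s (a (v N2) s) (a h s).
  have := gromov_product_add s (a (v N2)^-1%g s) (a (c * (u N1)^-1)%g s).
  rewrite gromov_product_iactV -[a (v N2) (a _ s)]iactM -/h.
  rewrite (metric_sym s) mdist_iactV iactM.
  rewrite (gromov_productC s (a (v N2)^-1%g s)).
  have := gromov_product_le_mdist s (a (v N2) s) (a (v N2) s).
  by have := vK N2 (leqnn _); lra.
(* The same with [h^-1]; moving the base point by [c] costs a second [C]. *)
have hVs : K <= gromov_product s (a (u N1) s) (a h^-1%g s).
  have := gromov_product_add s (a (u N1)^-1%g s) (a (c^-1 * (v N2)^-1)%g s).
  rewrite gromov_product_iactV -[a (u N1) (a _ s)]iactM.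
  have -> : (u N1 * (c^-1 * (v N2)^-1))%g = h^-1%g.
    by rewrite /h !invgM invgK mulgA.
  rewrite (metric_sym s) mdist_iactV iactM.
  have := gromov_product_base s (a c^-1%g s) (a (u N1)^-1%g s)
    (a c^-1%g (a (v N2)^-1%g s)).
  rewrite gromov_product_iactV iactVK (metric_sym s) mdist_iactV.
  have := gromov_product_le_mdist s (a (u N1) s) (a (u N1) s).
  by have := uK N1 (leqnn _); lra.
exists h => b Ub; have [z zb] := converges_to_ex b; apply: rV.
(* A sequence returning infinitely often to the direction of [h^-1 s] would be close to [p], putting
   [b] in [U]. *)
have zh : exists N, forall j, (N <= j)%N ->
    gromov_product s (z j) (a h^-1%g s) <= K.
  apply: contrapT => nz; apply: Ub; apply: rU.
  apply: (@lt_le_trans _ _ (r + 1)%:E); first by rewrite lte_fin ltrDl.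
  apply: (boundary_product_frequently hyp d0 up zb) => N.
  have [j Nj zK] : exists2 j, (N <= j)%N &
      K < gromov_product s (z j) (a h^-1%g s).
    apply: contrapT => nj; apply: nz; exists N => j Nj.
    by rewrite leNgt; apply/negP => zK; apply: nj; exists j.
  exists (maxn N N1), j; rewrite leq_maxl; split=> //.
  have := uK (maxn N N1) (leq_maxr _ _); move: zK hVs.
  have := gromov_product_or hyp s (a (u (maxn N N1)) s) (a (u N1) s) (z j).
  have := gromov_product_or hyp s (a (u N1) s) (a h^-1%g s) (z j).
  by rewrite (gromov_productC s (a h^-1%g s)) /K => -[?|?] [?|?] *; lra.
have [N zN] := zh.
apply: (@lt_le_trans _ _ (r' + 1)%:E); first by rewrite lte_fin ltrDl.
apply: (boundary_product_frequently hyp d0 vq (converges_to_iact h zb)) => n.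
pose j := maxn n N; pose i := maxn n N2; exists i, j.
rewrite !leq_maxl; split=> //=.
have := zN j (leq_maxr _ _); have := vK i (leq_maxr _ _).
(* As [z j] is away from [h^-1 s], its image is close to [h s], hence to [v s] and to [q]. *)
have := gromov_product_add s (a h^-1%g s) (z j).
rewrite gromov_product_iactV (metric_sym s) mdist_iactV.
rewrite (gromov_productC s (a h^-1%g s)).
have := gromov_product_le_mdist s (a h s) (a (v N2) s).
rewrite (gromov_productC s (a h s) (a (v N2) s)).
have := gromov_product_or hyp s (a (v i) s) (a (v N2) s) (a h (z j)).
have := gromov_product_or hyp s (a (v N2) s) (a h s) (a h (z j)).
by move: hs; rewrite /K => ? [?|?] [?|?] *; lra.
Qed.
End Action.

(** * The limit set and the conclusion *)

Section LimitSet.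
Context {G : groupType} {R : realType} {S : metricType R}.
Variable a : isometric_action G S.
Hypothesis hypS : hyperbolic_space S.

Lemma nbhs_limit_set (p : limit_set a) (U : set (limit_set a)) :
  nbhs p U <->
  exists2 W : set (boundary S), nbhs (set_val p) W & set_val @^-1` W `<=` U.
Proof.
split=> [|[W pW WU]].
  case=> _ /= [[W oW <-] /= Wp WU]; exists W => //.
  exact: open_nbhs_nbhs.
apply: (filterS WU).
exact: (@initial_continuous (limit_set a) (boundary S) set_val p W pW).
Qed.

Lemma general_type_infinite (s : S) : general_type a ->
  forall (Q : finGroupType) (f : G -> Q), ~ injective f.
Proof.
move=> [unb _] Q f f_inj; pose r x := xget 1%g [set g | f g = x].
have rK g : r (f g) = g.
  by apply: f_inj; rewrite /r; case: xgetP => [h _ fh|/(_ g)[]].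
pose D x y := mdist (a (r x) s) (a (r y) s).
(* The sum over all pairs bounds the diameter of the orbit; the default value of [r] off the image
   only adds nonnegative terms. *)
have [_ [_ [[g _ <-] [h _ <-]]]] := unb s (\sum_x \sum_y D x y).
apply/negP; rewrite -leNgt.
rewrite (bigD1 (f g)) //= (bigD1 (f h)) //= /D !rK -addrA lerDl.
by rewrite addr_ge0 // sumr_ge0 // => x _; rewrite ?sumr_ge0 // => *;
  exact: mdist_ge0.
Qed.

Lemma iact_limit_set_eq g p :
  iact_limit_set a g p = p <-> iact_boundary a g (set_val p) = set_val p.
Proof. by split=> [/(congr1 set_val)|gp]; last exact: val_inj. Qed.

Lemma limit_set_topologically_free : residually_finite G -> general_type a ->
  faithful_action (iact_limit_set a) -> topologically_free (iact_limit_set a).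
Proof.
move=> rf gt faith; apply: residually_finite_topologically_free => //.
- by move=> p; apply: val_inj; exact: iact_boundary1.
- by move=> g h p; apply: val_inj; exact: iact_boundaryM.
- move=> g p gp.
  have [|V pV gV] := @boundary_displace _ _ _ a hypS g (set_val p).
    by move=> /iact_limit_set_eq.
  exists (set_val @^-1` V); first by apply/nbhs_limit_set; exists V.
  by move=> q; exact: gV.
- move=> p q U V /nbhs_limit_set[U' pU' U'U] /nbhs_limit_set[V' qV' V'V].
  have [h hUV] :=
    boundary_compress hypS gt (set_mem (valP p)) (set_mem (valP q)) pU' qV'.
  by exists h => t Ut; apply: V'V; apply: hUV => /U'U.
- move=> Q f; have [_ [g [_ [[_ [p _]] _ _]]]] := gt.
  have [x _] := converges_to_ex p.
  exact: (general_type_infinite (x 0%N) gt).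
Qed.

End LimitSet.

Theorem corollary1p5 (R : realType) (G : groupType) :
  (residually_finite G -> faithful_weakly_hyperbolic R G -> lim_free R G) /\
  (finitely_generated G -> linear_group G ->
     faithful_weakly_hyperbolic R G -> lim_free R G).
Proof.
have lim_freeP :
    residually_finite G -> faithful_weakly_hyperbolic R G -> lim_free R G.
  move=> rf [S [a [hypS gt faith]]]; exists S, a; split=> //.
  exact: limit_set_topologically_free.
split=> // fg lin; exact/lim_freeP/linear_residually_finite.
Qed.
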